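(* Let $n\ge 2$ and let $A$ be an $n\times n$ matrix with entries in $\mathbf{C}(q^{1/2})$. Then $$\operatorname{bdet}(A)\,\operatorname{bdet}(A^{1n}_{1n})=\operatorname{bdet}(A_1^1)\,\operatorname{bdet}(A_n^n)-q^{n-1}\operatorname{bdet}(A_n^1)\,\operatorname{bdet}(A_1^n).$$
   Context: $\mathbf{C}(q^{1/2})$ is the field of complex rational functions in an indeterminate $q^{1/2}$, with $q=(q^{1/2})^2$. $S_m$ is the symmetric group on $[m]=\{1,\dots,m\}$. For $w\in S_m$, $N(w)=\{(i,j)\in[m]\times[m]\mid i<j \text{ and } w^{-1}(i)>w^{-1}(j)\}$, $\ell(w)=|N(w)|$, and $\beta(w)=\sum_{(i,j)\in N(w)}(j-i)$. The bigrassmannian determinant of an $m\times m$ matrix $M=(m_{ij})$ with entries in $\mathbf{C}(q^{1/2})$ is $$\operatorname{bdet}(M)=\sum_{w\in S_m}(-1)^{\ell(w)}q^{\beta(w)}\prod_{i=1}^m m_{i\,w(i)},$$ and $\operatorname{bdet}$ of the $0\times 0$ matrix is defined to be $1$. $A_i^j$ denotes the matrix obtained from $A$ by deleting the $i$-th row and the $j$-th column (with remaining rows and columns re-indexed consecutively in order); $A_{1n}^{1n}$ denotes the matrix obtained by deleting rows $1$ and $n$ and columns $1$ and $n$. *)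

(* Defs.v *)
From mathcomp Require Import all_boot all_order all_fingroup all_algebra.
From mathcomp Require Import complex.
From mathcomp Require Import reals.

Set Implicit Arguments.
Unset Strict Implicit.
Unset Printing Implicit Defensive.

Import GRing.Theory.

Local Open Scope ring_scope.

(* The rational function field C(q^{1/2}), the indeterminate q^{1/2} being the
   image of 'X; R[i] is the field of complex numbers when R : realType. *)
Definition Cq (R : realType) : fieldType := {fraction {poly R[i]}}.

Definition qhalf (R : realType) : Cq R := tofrac 'X.

Definition qq (R : realType) : Cq R := qhalf R ^+ 2.

(* [m] is represented by 'I_m, i.e. shifted to {0, ..., m - 1}; only order and
   differences of indices matter below. *)
Definition invset (m : nat) (w : 'S_m) : {set 'I_m * 'I_m} :=
  [set p : 'I_m * 'I_m | (p.1 < p.2)%N && ((w^-1)%g p.2 < (w^-1)%g p.1)%N].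

Definition len (m : nat) (w : 'S_m) : nat := #|invset w|.

(* The truncated subtraction is exact, as p.1 < p.2 on invset w. *)
Definition beta (m : nat) (w : 'S_m) : nat :=
  (\sum_(p in invset w) (p.2 - p.1))%N.

Definition bdet (R : realType) (m : nat) (M : 'M[Cq R]_m) : Cq R :=
  \sum_(w : 'S_m) (-1) ^+ len w * qq R ^+ beta w * \prod_(i < m) M i (w i).

Lemma bdet0 (R : realType) (M : 'M[Cq R]_0) : bdet M = 1.
Proof.
rewrite /bdet (eq_bigr (fun=> 1)) => [|w _].
  by rewrite sumr_const card_Sn fact0.
rewrite /len /beta (_ : invset w = set0) ?cards0 ?big_set0 ?big_ord0 ?mulr1 //.
by apply/setP => -[[]].
Qed.

Definition del (R : realType) (m n : nat) (i : 'I_m) (j : 'I_n)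
  (A : 'M[Cq R]_(m, n)) : 'M[Cq R]_(m.-1, n.-1) := row' i (col' j A).

(* Main.v *)
(** Since 2 beta(w) is the sum over i of (i - w(i))^2, bdet(A) is the ordinary
    determinant of B = (q^{(i-j)^2/2} a_ij). The minors of B obtained by deleting
    a first row and a first column, or a last row and a last column, are again of
    this form; in the two mixed minors the exponent (i-j)^2/2 is replaced by
    (i-j-1)^2/2 or (i-j+1)^2/2, and because the i - w(i) sum to 0 this multiplies
    every term of an m x m minor by q^{m/2}. The identity is thus the
    Desnanot-Jacobi (Dodgson condensation) identity for B. *)

Require Import Defs.
From mathcomp Require Import all_boot all_order all_fingroup all_algebra.
From mathcomp Require Import complex.
From mathcomp Require Import reals.
From mathcomp Require Import ring zify.

Set Implicit Arguments.
Unset Strict Implicit.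
Unset Printing Implicit Defensive.

Import Order.TTheory GRing.Theory Num.Theory.

Local Open Scope ring_scope.

(** * Length, signature and beta of a permutation *)

(** The map (i, j) -> (w j, w i) carries inversions by position to inversions by value. *)
Lemma card_inversions_invset (n : nat) (w : 'S_n) :
  #|[set p : 'I_n * 'I_n | (p.1 < p.2)%N && (w p.2 < w p.1)%N]| = len w.
Proof.
rewrite /len -[RHS](card_preimset _ (f := fun p => (w p.2, w p.1))) => [|p p'].
  by apply: eq_card => p; rewrite !inE /= !permK andbC.
by case: p p' => i j [i' j'] /= [/perm_inj-> /perm_inj->].
Qed.

(* Permuting the nodes 0 < ... < n - 1 of a Vandermonde determinant multiplies it
   by the signature, and flips the sign of one factor per inversion. *)
Lemma sign_len (R : comPzRingType) (n : nat) (w : 'S_n) :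
  (-1) ^+ len w = (-1) ^+ w :> R.
Proof.
suff E : (-1) ^+ len w = (-1) ^+ w :> int.
  by have := congr1 (intr : int -> R) E; rewrite !rmorphXn rmorphN rmorph1.
pose V (s : 'S_n) := Vandermonde n (\row_j (s j)%:Z).
have detV s : \det (V s) = \prod_(i < n) \prod_(j < n | (i < j)%N) ((s j)%:Z - (s i)%:Z).
  by rewrite det_Vandermonde; do 2!apply: eq_bigr => ? _; rewrite !mxE.
have VE : V w = col_perm w (V 1%g).
  by apply/matrixP => i j; rewrite !mxE perm1.
have detVw : \det (V w) = (-1) ^+ w * \det (V 1%g).
  by rewrite VE col_permE det_mulmx det_perm odd_permV mulrC.
have detV1 : 0 < \det (V 1%g).
  rewrite detV; apply: prodr_gt0 => i _; apply: prodr_gt0 => j ij.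
  by rewrite !perm1 subr_gt0 ltz_nat.
have norm_detVw : `|\det (V w)| = \det (V 1%g).
  by rewrite detVw normrM normr_sign mul1r gtr0_norm.
(* With x = [\det (V w)], the claim becomes (-1)^len |x| = x, checked factor by factor. *)
apply: (mulIf (lt0r_neq0 detV1)); rewrite -detVw -norm_detVw detV.
rewrite -card_inversions_invset -sum1_card -prodrXr !pair_big_dep /=.
rewrite normr_prod (eq_bigl (fun p : 'I_n * 'I_n => (p.1 < p.2)%N && (w p.2 < w p.1)%N)); last first.
  by move=> p; rewrite inE.
rewrite big_mkcondr -big_split /=; apply: eq_bigr => -[i j] /= ij.
case: ltnP => h.
  by rewrite expr1 mulN1r ltr0_norm ?opprK// subr_lt0 ltz_nat.
by rewrite mul1r ger0_norm// subr_ge0 lez_nat.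
Qed.

(* The indicators satisfy [i < j] - [u i < u j] = 1, -1 or 0 according to
   whether (i, j), (j, i) or neither is an inversion, so that summing over all
   ordered pairs counts each inversion twice. *)
Lemma beta_sum_sqr (n : nat) (w : 'S_n) :
  (2 * beta w)%:Z = \sum_(i < n) (i%:Z - (w i)%:Z) ^+ 2.
Proof.
pose u := (w^-1)%g; pose T (i j : 'I_n) : int :=
  ((i < j)%N && (u j < u i)%N)%:Z * (j%:Z - i%:Z).
have betaE : (beta w)%:Z = \sum_i \sum_j T i j.
  rewrite /beta pair_big /= (big_morph _ PoszD (erefl _)).
  rewrite big_mkcond; apply: eq_bigr => -[i j] _; rewrite inE /T /=.
  by case: ifP => [/andP[ij _]|_]; rewrite ?mul0r ?mul1r// subzn ?(ltnW ij).
have below (k : nat) : (k <= n)%N -> \sum_(i < n) (i < k)%N%:Z = k%:Z.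
  move=> kn; rewrite -(big_morph _ PoszD (erefl _)) -big_mkcond /=; congr Posz.
  by rewrite (big_ord_narrow kn) sum1_card card_ord.
have above (k : 'I_n) : \sum_(i < n) (k < i)%N%:Z = n%:Z - 1 - k%:Z.
  have -> : \sum_(i < n) (k < i)%N%:Z = \sum_(i < n) (1 - (i < k.+1)%N%:Z).
    by apply: eq_bigr => i _; rewrite ltnS; case: leqP.
  by rewrite sumrB below// sumr_const card_ord; lia.
have reu (F : 'I_n -> int) : \sum_i F (u i) = \sum_i F i.
  by rewrite [RHS](reindex_inj (@perm_inj _ u)).
have sumT : (2 * beta w)%:Z =
    \sum_(i < n) \sum_(j < n) (j%:Z - i%:Z) * ((i < j)%N%:Z - (u i < u j)%N%:Z).
  rewrite mul2n -addnn PoszD betaE [X in _ + X]exchange_big -big_split /=.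
  apply: eq_bigr => i _; rewrite -big_split; apply: eq_bigr => j _; rewrite /T /=.
  case: (ltngtP (u i) (u j)) => [||/ord_inj/perm_inj->]; last by rewrite subrr !mulr0.
    by case: (ltngtP i j) => /=; lia.
  by case: (ltngtP i j) => /=; lia.
(* For fixed j, exactly j indices i satisfy i < j, and [u j] of them satisfy [u i < u j]. *)
have sum_right : \sum_(i < n) \sum_(j < n) j%:Z * ((i < j)%N%:Z - (u i < u j)%N%:Z) =
    \sum_(j < n) j%:Z * (j%:Z - (u j)%:Z).
  rewrite exchange_big; apply: eq_bigr => j _ /=; rewrite -mulr_sumr sumrB.
  rewrite (reu (fun i => (i < u j)%N%:Z)) !below//; exact: ltnW.
have sum_left : \sum_(i < n) \sum_(j < n) i%:Z * ((i < j)%N%:Z - (u i < u j)%N%:Z) =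
    - \sum_(j < n) j%:Z * (j%:Z - (u j)%:Z).
  rewrite -sumrN; apply: eq_bigr => i _; rewrite -mulr_sumr sumrB.
  by rewrite (reu (fun j => (u i < j)%N%:Z)) !above; ring.
have -> : \sum_(i < n) (i%:Z - (w i)%:Z) ^+ 2 = \sum_(j < n) ((u j)%:Z - j%:Z) ^+ 2.
  rewrite [LHS](reindex_inj (@perm_inj _ u)).
  by apply: eq_bigr => j _; rewrite permKV.
(* Arranged so that the two sums of squares cancel, [u] being a permutation. *)
have -> : \sum_(j < n) ((u j)%:Z - j%:Z) ^+ 2 =
    \sum_j (u j)%:Z ^+ 2 - \sum_(j < n) j%:Z ^+ 2
    + 2 * \sum_(j < n) j%:Z * (j%:Z - (u j)%:Z).
  rewrite mulr_sumr -sumrB -big_split; apply: eq_bigr => j _ /=; ring.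
rewrite (reu (fun j => j%:Z ^+ 2)) subrr add0r sumT.
under eq_bigr do (under eq_bigr do rewrite mulrBl; rewrite sumrB).
by rewrite sumrB sum_right sum_left; ring.
Qed.

(** * The Desnanot-Jacobi identity over a commutative ring *)

(** Expanding along the second row, a unit vector, removes the middle rows one at a time. *)
Lemma det_two_rows (R : comNzRingType) (n : nat) (M : 'M[R]_(n.+2)) :
  (forall i j, i != ord0 -> i != ord_max -> M i j = (i == j)%:R) ->
  \det M = M ord0 ord0 * M ord_max ord_max - M ord0 ord_max * M ord_max ord0.
Proof.
elim: n M => [|n IHn] M idM.
  rewrite (expand_det_row _ ord0) !big_ord_recl big_ord0 /cofactor !det_mx11 !mxE /=.
  rewrite (_ : ord_max = lift ord0 ord0); last exact: val_inj.
  rewrite (_ : lift (lift ord0 ord0) ord0 = ord0); last exact: val_inj.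
  by ring.
pose i1 : 'I_n.+3 := lift ord0 ord0.
rewrite (expand_det_row _ i1) (bigD1 i1)//= idM// eqxx mul1r.
rewrite big1 => [|j ji1]; last by rewrite idM// eq_sym (negPf ji1) mul0r.
have l0 : lift i1 ord0 = ord0 :> 'I_n.+3 by apply: val_inj.
have lmax : lift i1 ord_max = ord_max :> 'I_n.+3 by apply: val_inj.
rewrite addr0 /cofactor expr2 mulrNN !mul1r IHn => [|i j i0 imax].
  by rewrite !mxE l0 lmax.
rewrite !mxE idM ?(inj_eq lift_inj)//.
  by rewrite -l0 (inj_eq lift_inj).
by rewrite -lmax (inj_eq lift_inj).
Qed.

Lemma det_scalar_extreme_rows (R : comPzRingType) (n : nat) (d : R) (N : 'M[R]_(n.+2)) :
  (forall j, N ord0 j = d * (ord0 == j)%:R) ->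
  (forall j, N ord_max j = d * (ord_max == j)%:R) ->
  \det N = d * (d * \det (row' ord0 (col' ord0 (row' ord_max (col' ord_max N))))).
Proof.
move=> N0 Nm.
rewrite (expand_det_row _ ord_max) (bigD1 ord_max)//= big1 => [|j jm]; last first.
  by rewrite Nm eq_sym (negPf jm) mulr0 mul0r.
rewrite Nm eqxx mulr1 addr0 /cofactor -signr_odd addnn odd_double mul1r; congr (_ * _).
have l0 : lift ord_max ord0 = ord0 :> 'I_n.+2 by apply: val_inj.
rewrite (expand_det_row _ ord0) (bigD1 ord0)//= big1 => [|j j0]; last first.
  by rewrite !mxE l0 N0 -l0 (inj_eq lift_inj) eq_sym (negPf j0) mulr0 mul0r.
by rewrite !mxE l0 N0 eqxx mulr1 addr0 /cofactor mul1r.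
Qed.

(* Multiply [A] on the left by the identity matrix whose extreme rows are
   replaced with those of the adjugate. *)
Lemma desnanot_jacobi_mul (R : comNzRingType) (n : nat) (A : 'M[R]_(n.+2)) :
  \det A * (\det A * \det (row' ord0 (col' ord0 (row' ord_max (col' ord_max A))))) =
  \det A * (\det (row' ord0 (col' ord0 A)) * \det (row' ord_max (col' ord_max A))
  - \det (row' ord_max (col' ord0 A)) * \det (row' ord0 (col' ord_max A))).
Proof.
pose M := \matrix_(i, j) if (i == ord0) || (i == ord_max) then \adj A i j
                         else (i == j)%:R.
(* The extreme rows come from [\adj A *m A = (\det A)%:M]. *)
have MA i j : (M *m A) i j = if (i == ord0) || (i == ord_max)
    then \det A * (i == j)%:R else A i j.
  transitivity ((if (i == ord0) || (i == ord_max) then \adj A *m A else A) i j).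
    case: ifP => h; rewrite !mxE.
      by apply: eq_bigr => k _; rewrite mxE h.
    rewrite (bigD1 i)//= !mxE h eqxx mul1r big1 ?addr0// => k ki.
    by rewrite mxE h eq_sym (negPf ki) mul0r.
  by case: ifP => // _; rewrite mul_adj_mx mxE mulr_natr.
have detMA : \det (M *m A) =
  \det A * (\det A * \det (row' ord0 (col' ord0 (row' ord_max (col' ord_max A))))).
  move: (M *m A) MA => N NE.
  rewrite (@det_scalar_extreme_rows _ _ (\det A)) => [|j|j]; try by rewrite NE eqxx ?orbT.
  do 2!congr (_ * _); congr (\det _); apply/matrixP => i j; rewrite !mxE NE ifF//.
  rewrite -!val_eqE /= /bump; have := ltn_ord i; lia.
have detM : \det M = \det (row' ord0 (col' ord0 A)) * \det (row' ord_max (col' ord_max A))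
  - \det (row' ord_max (col' ord0 A)) * \det (row' ord0 (col' ord_max A)).
  rewrite det_two_rows => [|i j i0 im]; last by rewrite mxE (negPf i0) (negPf im).
  rewrite !mxE eqxx eqxx orbT /cofactor /=.
  rewrite add0n addn0 -(signr_odd _ (n.+1 + n.+1)) addnn odd_double !mul1r.
  congr (_ - _).
  (* The two mixed cofactors carry the same sign (-1)^(n+1), which squares to 1. *)
  by rewrite mulrACA -exprD addnn -signr_odd odd_double mul1r mulrC.
by rewrite -detMA det_mulmx detM mulrC.
Qed.

Lemma desnanot_jacobi (R : comNzRingType) (n : nat) (A : 'M[R]_(n.+2)) :
  \det A * \det (row' ord0 (col' ord0 (row' ord_max (col' ord_max A)))) =
  \det (row' ord0 (col' ord0 A)) * \det (row' ord_max (col' ord_max A))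
  - \det (row' ord_max (col' ord0 A)) * \det (row' ord0 (col' ord_max A)).
Proof.
(* [\det A] need not be cancellable, but [\det ('X + A)] is monic. *)
pose B := char_poly_mx (- A).
have lregB : GRing.lreg (\det B).
  have := char_poly_monic (- A); rewrite /char_poly => /monicP m.
  by apply: lreg_lead; rewrite m; apply: lreg1.
have ev0 m (C : 'M[{poly R}]_m) : (\det C).[0] = \det (map_mx (horner_eval 0) C).
  by rewrite -horner_evalE det_map_mx.
have evB : map_mx (horner_eval 0) B = A.
  apply/matrixP => i j; rewrite !mxE /horner_eval hornerD hornerMn hornerX mul0rn.
  by rewrite hornerN hornerC add0r opprK.
have evminor m (C : 'M[{poly R}]_(m.+1)) i j :
    map_mx (horner_eval 0) (row' i (col' j C) : 'M_m) =
    row' i (col' j (map_mx (horner_eval 0) C)).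
  by apply/matrixP => k l; rewrite !mxE.
(* Cancel [\det B], then evaluate at 0, where [B] specializes to [A]. *)
have := congr1 (horner^~ 0) (lregB _ _ (desnanot_jacobi_mul B)) => /=.
by rewrite !hornerE !ev0 !evminor evB.
Qed.

(** * Bigrassmannian determinants as weighted determinants *)

Lemma det_weighted (R : comPzRingType) (n : nat) (x : R) (e : nat -> nat -> nat)
    (M : 'M[R]_n) :
  \det (\matrix_(i, j) (x ^+ e i j * M i j)) =
  \sum_(w : 'S_n) (-1) ^+ w * (x ^+ (\sum_(i < n) e i (w i))%N * \prod_i M i (w i)).
Proof.
apply: eq_bigr => w _; rewrite -prodrXr -big_split; congr (_ * _).
by apply: eq_bigr => i _; rewrite mxE.
Qed.

(* Truncated subtraction: one of the two summands is [|i - j|], the other 0. *)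
Definition sqrdist (i j : nat) : nat := ((i - j) + (j - i)) ^ 2.

Lemma sqrdistE (i j : nat) : (sqrdist i j)%:Z = (i%:Z - j%:Z) ^+ 2.
Proof. by rewrite /sqrdist expr2; case: (leqP i j) => h; nia. Qed.

Lemma sum_sqrdist (n : nat) (w : 'S_n) :
  (\sum_(i < n) sqrdist i (w i) = 2 * beta w)%N.
Proof.
apply/eqP; rewrite -eqz_nat beta_sum_sqr (big_morph _ PoszD (erefl _)); apply/eqP.
by apply: eq_bigr => i _; rewrite sqrdistE.
Qed.

Lemma sum_sqrdist_shift (n : nat) (w : 'S_n) :
  (\sum_(i < n) sqrdist i (w i).+1 = n + \sum_(i < n) sqrdist i (w i))%N.
Proof.
have sumw : (\sum_(i < n) w i = \sum_(i < n) i)%N.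
  by rewrite [RHS](reindex_inj (@perm_inj _ w)).
(* This is (i-j-1)^2 = (i-j)^2 + 1 - 2(i-j), rearranged to stay within [nat]. *)
have sqrdistS i j : (sqrdist i j.+1 + 2 * i = 1 + sqrdist i j + 2 * j)%N.
  by apply/eqP; rewrite -eqz_nat !PoszD !sqrdistE; apply/eqP; lia.
apply: (@addIn (\sum_(i < n) 2 * i)%N); rewrite -big_split /=.
under eq_bigr do rewrite sqrdistS.
by rewrite !big_split /= !sumw sum1_card card_ord.
Qed.

Lemma bdet_det (R : realType) (n : nat) (M : 'M[Cq R]_n) :
  bdet M = \det (\matrix_(i, j) (qhalf R ^+ sqrdist i j * M i j)).
Proof.
rewrite det_weighted; apply: eq_bigr => w _.
by rewrite sign_len sum_sqrdist exprM mulrA.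
Qed.

(** These weights arise when the last row and the first column are deleted. *)
Lemma det_shift_col (R : realType) (n : nat) (M : 'M[Cq R]_n) :
  \det (\matrix_(i, j) (qhalf R ^+ sqrdist i j.+1 * M i j)) = qhalf R ^+ n * bdet M.
Proof.
rewrite bdet_det (det_weighted _ (fun i j => sqrdist i j.+1)) det_weighted mulr_sumr.
by apply: eq_bigr => w _; rewrite sum_sqrdist_shift exprD -mulrA mulrCA.
Qed.

Lemma det_shift_row (R : realType) (n : nat) (M : 'M[Cq R]_n) :
  \det (\matrix_(i, j) (qhalf R ^+ sqrdist i.+1 j * M i j)) = qhalf R ^+ n * bdet M.
Proof.
(* [sqrdist] is symmetric, so transposition preserves [bdet] and exchanges the two shifts. *)
have bdet_tr : bdet M = bdet M^T.
  rewrite !bdet_det -[LHS]det_tr; congr (\det _); apply/matrixP => i j.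
  by rewrite !mxE /sqrdist addnC.
rewrite bdet_tr -det_shift_col -[LHS]det_tr; congr (\det _).
by apply/matrixP => i j; rewrite !mxE /sqrdist addnC.
Qed.

(* The matrix has size n.+2 >= 2; rows and columns 1 and n.+2 of the usual
   1-based numbering are ord0 and ord_max. *)
Theorem theorem4p6 (R : realType) (n : nat) (A : 'M[Cq R]_(n.+2)) :
  bdet A * bdet (del ord0 ord0 (del ord_max ord_max A)) =
  bdet (del ord0 ord0 A) * bdet (del ord_max ord_max A)
  - qq R ^+ n.+1 * bdet (del ord_max ord0 A) * bdet (del ord0 ord_max A).
Proof.
pose B := \matrix_(i, j) (qhalf R ^+ sqrdist i j * A i j).
(* [lift ord0] raises an index by 1 and [lift ord_max] keeps its value, so i - j changes only in the
   mixed minors. *)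
have minor00 : bdet (del ord0 ord0 A) = \det (row' ord0 (col' ord0 B)).
  by rewrite bdet_det; congr (\det _); apply/matrixP => i j; rewrite !mxE.
have minormm : bdet (del ord_max ord_max A) = \det (row' ord_max (col' ord_max B)).
  by rewrite bdet_det; congr (\det _); apply/matrixP => i j; rewrite !mxE !lift_max.
have minorm0 : qhalf R ^+ n.+1 * bdet (del ord_max ord0 A) =
    \det (row' ord_max (col' ord0 B)).
  rewrite -det_shift_col; congr (\det _); apply/matrixP => i j.
  by rewrite !mxE lift_max.
have minor0m : qhalf R ^+ n.+1 * bdet (del ord0 ord_max A) =
    \det (row' ord0 (col' ord_max B)).
  rewrite -det_shift_row; congr (\det _); apply/matrixP => i j.
  by rewrite !mxE lift_max.
have inner : bdet (del ord0 ord0 (del ord_max ord_max A)) =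
    \det (row' ord0 (col' ord0 (row' ord_max (col' ord_max B)))).
  rewrite bdet_det; congr (\det _); apply/matrixP => i j.
  by rewrite !mxE !lift_max.
rewrite [bdet A]bdet_det inner desnanot_jacobi -minor00 -minormm -minorm0 -minor0m.
(* The two factors q^{(n+1)/2} of the mixed minors combine to q^{n+1}. *)
by rewrite /qq -exprM mulnC exprM expr2; ring.
Qed.
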